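(* Let $k$ be a commutative ring. Let $\Omega^+_n$ denote the augmented cycle-free $(n \times n)$-chessboard complex, where the unique $(-1)$-chain is represented by the empty $n \times n$ chessboard, and the boundary map on $0$-chains takes a vertex to the unique $(-1)$-chain. For each $p \geq 0$, there is a chain isomorphism $$\omega_* : k\left[S\Omega^+_{p+1}\right] \to Sym_*^{(p)}.$$
   Context: Cycle-free chessboard complex $\Omega_n$: the $m$-chains ($m\ge 0$) are generated by lists $L=\{(i_0,j_0),\dots,(i_m,j_m)\}$ with $1\le i_0<i_1<\dots<i_m\le n$, the $j_s\in\{1,\dots,n\}$ distinct, and $L$ cycle-free, meaning that no nonempty subset of $L$ can be ordered as $\{(\ell_0,\ell_1),(\ell_1,\ell_2),\dots,(\ell_{t-1},\ell_t),(\ell_t,\ell_0)\}$ (in particular no pair $(\ell,\ell)$ occurs). The differential is $d\{(i_0,j_0),\dots,(i_m,j_m)\}=\sum_{s=0}^m(-1)^s\{\dots,\widehat{(i_s,j_s)},\dots\}$. $k[S\Omega^+_{n}]$ is the suspended augmented complex: the free $k$-module in degree $m+1$ on the $m$-chain generators of $\Omega_n^+$, $m\ge-1$. The complex $Sym^{(p)}_*$: $\mathrm{Epi}_{\Delta S}([p],[q])$ is the set of formal tensor products $Z_0\otimes\dots\otimes Z_q$ of nonempty noncommutative monomials in $z_0,\dots,z_p$, each $z_j$ occurring exactly once in total. $Sym^{(p)}_i$ ($0\le i\le p$) is the $k$-module $k[\mathrm{Epi}_{\Delta S}([p],[p-i])]$ modulo $Z_0\otimes\dots\otimes Z_r\otimes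 Z_{r+1}\otimes\dots\otimes Z_{p-i}\approx(-1)^{ab}Z_0\otimes\dots\otimes Z_{r+1}\otimes Z_r\otimes\dots\otimes Z_{p-i}$, where $a=\deg Z_r$, $b=\deg Z_{r+1}$, and $\deg(Z)$ is the number of factors of the monomial $Z$ minus one. For monomials, $\partial_i(z_{j_0}\cdots z_{j_s})=z_{j_0}\cdots z_{j_i}\otimes z_{j_{i+1}}\cdots z_{j_s}$ if $0\le i<s$ and $0$ otherwise; on tensors $\partial_i(W\otimes V)=\partial_i(W)\otimes V+W\otimes\partial_{i-\deg(W)}(V)$, where $\deg(W_0\otimes\dots\otimes W_t)=\sum\deg(W_k)$. The boundary $Sym^{(p)}_n\to Sym^{(p)}_{n-1}$ is $d_n=\sum_{i=0}^{n-1}(-1)^i\partial_i$. *)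

(* Defs.v *)
From HB Require Import structures.
From mathcomp Require Import all_boot all_order all_algebra zify.
From mathcomp Require Import generic_quotient boolp.

Set Implicit Arguments.
Unset Strict Implicit.
Unset Printing Implicit Defensive.

Import Order.TTheory GRing.Theory Num.Theory.
Local Open Scope ring_scope.

(** * Chain complexes of k-modules, concentrated in degrees n >= 0 *)

Section ChainComplexes.
Variable k : pzRingType.

Record chainComplex := ChainComplex {
  chain_obj :> nat -> lmodType k;
  chain_d : forall n, {linear chain_obj n.+1 -> chain_obj n};
  chain_dd : forall n x, chain_d n (chain_d n.+1 x) = 0
}.

Record chainMap (C D : chainComplex) := ChainMap {
  chain_map :> forall n, {linear C n -> D n};
  chain_map_d : forall n x,
    chain_map n (chain_d C n x) = chain_d D n (chain_map n.+1 x)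
}.

(** The degreewise inverses are automatically linear and commute with the
    differentials. *)
Definition chain_isomorphism (C D : chainComplex) (w : chainMap C D) : Prop :=
  forall n, bijective (w n).

End ChainComplexes.

(** * Free modules on finite sets *)

Section FreeModule.
Variables (k : pzRingType) (X : finType).

Definition freeMod : Type := {ffun X -> k^o}.
HB.instance Definition _ := GRing.Lmodule.on freeMod.

Definition gen (x : X) : freeMod := [ffun y => (y == x)%:R].

Variables (V : lmodType k) (f : X -> V).

Definition lin_ext (v : freeMod) : V := \sum_x (v x : k) *: f x.

Fact lin_ext_linear : linear lin_ext.
Proof.
move=> a u v; rewrite /lin_ext scaler_sumr -big_split /=.
by apply: eq_bigr => x _; rewrite !ffunE scalerDl scalerA.
Qed.
HB.instance Definition _ :=
  GRing.isLinear.Build k freeMod V _ lin_ext lin_ext_linear.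

End FreeModule.

Lemma lin_ext_gen (k : pzRingType) (X : finType) (V : lmodType k)
    (f : X -> V) (x : X) : lin_ext f (gen k x) = f x.
Proof.
rewrite /lin_ext (bigD1 x) //= ffunE eqxx scale1r big1 ?addr0 // => y nyx.
by rewrite ffunE (negPf nyx) scale0r.
Qed.

Lemma linear_gen0 (k : pzRingType) (X : finType) (V : lmodType k)
    (f : {linear freeMod k X -> V}) :
  (forall x, f (gen k x) = 0) -> forall v, f v = 0.
Proof.
move=> f0 v; have -> : v = \sum_x (v x : k) *: gen k x.
  apply/ffunP => x; rewrite sum_ffunE (bigD1 x) //= big1 => [|y nyx].
    by rewrite !ffunE eqxx addr0 [RHS]mulr1.
  by rewrite !ffunE eq_sym (negPf nyx) scaler0.
by rewrite linear_sum big1 // => x _; rewrite linearZ /= f0 scaler0.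
Qed.

(** * Quotient of a module by the submodule spanned by a set of elements *)

Section Span.
Variables (k : pzRingType) (V : lmodType k) (G : V -> Prop).

Inductive in_span : V -> Prop :=
| in_span0 : in_span 0
| in_spanZD (a : k) (g v : V) : G g -> in_span v -> in_span (a *: g + v).

Definition span_pred : V -> bool := fun v => `[< in_span v >].

Fact span_closed : submod_closed span_pred.
Proof.
split=> [|a u v /asboolP uS /asboolP vS]; apply/asboolP; first exact: in_span0.
elim: uS => [|b g w Gg _ IH]; first by rewrite scaler0 add0r.
by rewrite scalerDr scalerA -addrA; apply: in_spanZD.
Qed.
HB.instance Definition _ := GRing.isSubmodClosed.Build k V span_pred span_closed.
Definition span : submodClosed V := GRing.SubmodClosed.clone k V span_pred _.

Lemma span_gen g : G g -> g \in span.
Proof.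
move=> Gg; apply/asboolP; rewrite -[g]addr0 -[g]scale1r.
by apply: in_spanZD => //; apply: in_span0.
Qed.

End Span.

Section LQuotient.
Variables (k : pzRingType) (V : lmodType k) (I : submodClosed V).
Local Open Scope quotient_scope.

Definition submod_pred : V -> bool := fun v => v \in I.
Fact submod_pred_closed : zmod_closed submod_pred.
Proof. exact: GRing.submod_closedB (submodClosedP I). Qed.
HB.instance Definition _ :=
  GRing.isZmodClosed.Build V submod_pred submod_pred_closed.

Local Notation lquotZ :=
  (@Quotient.quot V (GRing.ZmodClosed.clone V submod_pred _)).
Definition lquot : Type := lquotZ.
HB.instance Definition _ := GRing.Zmodule.on lquot.

Definition lquot_pi (v : V) : lquot := \pi_(lquotZ) v.
Definition lquot_repr (x : lquot) : V := repr (x : lquotZ).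

Lemma lquot_reprK : cancel lquot_repr lquot_pi.
Proof. by move=> x; apply: reprK. Qed.

Lemma lquot_piP u v : lquot_pi u = lquot_pi v <-> u - v \in I.
Proof.
rewrite -[u - v \in I]/(u - v \in submod_pred) Quotient.idealrBE.
by split=> /eqP.
Qed.

Lemma lquot_piD u v : lquot_pi (u + v) = lquot_pi u + lquot_pi v.
Proof. by rewrite /lquot_pi; exact: (raddfD (\pi_(lquotZ))). Qed.

Definition lquot_scale (a : k) (x : lquot) : lquot :=
  lquot_pi (a *: lquot_repr x).

Lemma lquot_scaleE a v : lquot_scale a (lquot_pi v) = lquot_pi (a *: v).
Proof.
apply/lquot_piP; rewrite -scalerBr rpredZ //.
by apply/lquot_piP; rewrite lquot_reprK.
Qed.

Fact lquot_scaleA a b x :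
  lquot_scale a (lquot_scale b x) = lquot_scale (a * b) x.
Proof. by rewrite -[x]lquot_reprK !lquot_scaleE scalerA. Qed.
Fact lquot_scale1 : left_id 1 lquot_scale.
Proof. by move=> x; rewrite -[x]lquot_reprK lquot_scaleE scale1r. Qed.
Fact lquot_scaleDr : right_distributive lquot_scale +%R.
Proof.
move=> a x y; rewrite -[x]lquot_reprK -[y]lquot_reprK.
by rewrite -lquot_piD !lquot_scaleE scalerDr lquot_piD.
Qed.
Fact lquot_scaleDl x : {morph lquot_scale^~ x : a b / a + b}.
Proof.
move=> a b /=; rewrite -[x]lquot_reprK !lquot_scaleE.
by rewrite scalerDl lquot_piD.
Qed.
HB.instance Definition _ := GRing.Zmodule_isLmodule.Build k lquot
  lquot_scaleA lquot_scale1 lquot_scaleDr lquot_scaleDl.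

Fact lquot_pi_linear : linear lquot_pi.
Proof. by move=> a u v; rewrite lquot_piD -lquot_scaleE. Qed.
HB.instance Definition _ :=
  GRing.isLinear.Build k V lquot _ lquot_pi lquot_pi_linear.

End LQuotient.

Section LQuotientMap.
Variables (k : pzRingType) (V W : lmodType k).
Variables (I : submodClosed V) (J : submodClosed W) (f : {linear V -> W}).

(** Meaningful only under [sub_fIJ] below. *)
Definition lquot_map (x : lquot I) : lquot J := lquot_pi J (f (lquot_repr x)).

Hypothesis sub_fIJ : forall v, v \in I -> f v \in J.

Lemma lquot_mapE v : lquot_map (lquot_pi I v) = lquot_pi J (f v).
Proof.
apply/lquot_piP; rewrite -linearB; apply: sub_fIJ.
by apply/lquot_piP; rewrite lquot_reprK.
Qed.

Lemma lquot_map_linear : linear lquot_map.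
Proof.
move=> a x y; rewrite -[x]lquot_reprK -[y]lquot_reprK.
by rewrite -linearP !lquot_mapE !linearP.
Qed.

End LQuotientMap.

(** * Alternating double sums *)

Lemma alternating_sum0 (k : pzRingType) (V : lmodType k) (m : nat)
    (F : nat -> nat -> V) :
  (forall i j, (j < i <= m)%N -> F i j = F j i.-1) ->
  \sum_(i < m.+1) \sum_(j < m) (-1) ^+ (i + j) *: F i j = 0.
Proof.
elim: m => [|m IH] FE; first by rewrite big1 // => i _; rewrite big_ord0.
rewrite big_ord_recr /=; under eq_bigr do rewrite big_ord_recr /=.
rewrite big_split /= IH ?add0r => [|i j /andP[ji im]]; last first.
  by apply: FE; rewrite ji ltnW.
rewrite -big_split big1 //= => i _.
rewrite (FE m.+1 i) ?ltn_ord ?leqnn // addSn addnC exprS mulN1r scaleNr.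
by rewrite subrr.
Qed.

(** * The cycle-free chessboard complex *)

(** A cycle is given by its distinct vertices [l_0, ..., l_t]; since
    [t < N] it suffices to let [c] range over lists of length at most [N]
    (see [cycle_freeP]). *)
Definition cycle_free (N : nat) (L : seq ('I_N * 'I_N)) : bool :=
  ~~ [exists c : {bseq N of 'I_N},
        (c != [::] :> seq _) && ucycleb [rel i j | (i, j) \in L] c].

Lemma cycle_freeP (N : nat) (L : seq ('I_N * 'I_N)) :
  reflect (forall c : seq 'I_N, c != [::] -> uniq c ->
             ~~ all (mem L) (zip c (rot 1 c)))
          (cycle_free L).
Proof.
have cycleE (c : seq 'I_N) :
    cycle [rel i j | (i, j) \in L] c = all (mem L) (zip c (rot 1 c)).
  case: c => [|x c] //=; rewrite rot1_cons.
  elim: c {1 3}x => [|y c IH] z //=.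
  by rewrite IH.
apply: (iffP idP) => [cf c c0 cU|cf].
  apply/negP => cL; case/existsP: cf.
  have sc : (size c <= N)%N by rewrite -(card_uniqP cU) -[leqRHS]card_ord max_card.
  by exists (Bseq sc); rewrite /= c0 /ucycleb cycleE cL.
apply/existsP=> -[c /and3P[c0 cL cU]].
by move/negP: (cf c c0 cU); rewrite -cycleE.
Qed.

(** The board is indexed by [{0, ..., N-1}].  A placement of [m] rooks is an
    [(m-1)]-chain generator; in particular [m = 0] is the empty board. *)
Definition is_placement (N m : nat) (L : seq ('I_N * 'I_N)) : bool :=
  [&& size L == m, sorted ltn [seq val x.1 | x <- L],
      uniq [seq x.2 | x <- L] & cycle_free L].

Record placement (N m : nat) := Placement {
  placement_val :> seq ('I_N * 'I_N);
  placementP : is_placement m placement_val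
}.
HB.instance Definition _ N m := [isSub for @placement_val N m].
HB.instance Definition _ N m := [Choice of placement N m by <:].

Definition placement_code N m (L : placement N m) :
  option (m.-tuple ('I_N * 'I_N)) := insub (val L).
Definition placement_decode N m (t : option (m.-tuple ('I_N * 'I_N))) :
  option (placement N m) := obind (fun t => insub (val t)) t.
Fact placement_codeK N m : pcancel (@placement_code N m) (@placement_decode N m).
Proof.
move=> L; have /and4P[sL _ _ _] := placementP L.
by rewrite /placement_code insubT /= valK.
Qed.
HB.instance Definition _ N m := Countable.copy (placement N m)
  (pcan_type (@placement_codeK N m)).
HB.instance Definition _ N m : isFinite (placement N m) :=
  PCanIsFinite (@placement_codeK N m).

Section Face.
Variable T : eqType.
Implicit Types s : seq T.

Definition omit (i : nat) s : seq T := take i s ++ drop i.+1 s.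

Lemma size_omit i s : (i < size s)%N -> size (omit i s) = (size s).-1.
Proof.
move=> ls; rewrite size_cat size_takel 1?ltnW // size_drop subnS.
by move: ls; case: (size s) => // n; rewrite ltnS => le; rewrite subSn //= subnKC.
Qed.

Lemma omit_subseq i s : subseq (omit i s) s.
Proof.
rewrite -{2}(cat_take_drop i s) cat_subseq //.
by rewrite -add1n -drop_drop drop_subseq.
Qed.

Lemma omit_omit i j s : (j < i)%N -> omit j (omit i s) = omit i.-1 (omit j s).
Proof.
elim: s i j => [|x s IH] [|i] [|j] // ji.
  by rewrite /omit /= !drop0.
case: i ji => // i ji; have := IH i.+1 j ji.
by rewrite /omit /= => ->.
Qed.

End Face.

Lemma is_placement_omit N m i (L : seq ('I_N * 'I_N)) :
  (i < m.+1)%N -> is_placement m.+1 L -> is_placement m (omit i L).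
Proof.
move=> im /and4P[/eqP sL sorL uL cfL]; have sub := omit_subseq i L.
apply/and4P; split.
- by rewrite size_omit sL.
- by apply: subseq_sorted sorL; [apply: ltn_trans | apply: map_subseq].
- by apply: subseq_uniq uL; apply: map_subseq.
- apply/cycle_freeP => c c0 cU; apply: contra ((cycle_freeP _ cfL) c c0 cU).
  by apply: sub_all => x; apply: mem_subseq.
Qed.

Section Chessboard.
Variables (k : pzRingType) (N : nat).

Definition face m (L : placement N m.+1) (s : 'I_m.+1) : placement N m :=
  Placement (is_placement_omit (ltn_ord s) (placementP L)).

Definition chess_d m : freeMod k (placement N m.+1) -> freeMod k (placement N m) :=
  lin_ext (fun L => \sum_(s < m.+1) (-1) ^+ s *: gen k (face L s)).
HB.instance Definition _ m := GRing.Linear.on (@chess_d m).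

Fact chess_dd m v : @chess_d m (@chess_d m.+1 v) = 0.
Proof.
pose raw t : freeMod k (placement N m) := [ffun x => (val x == t)%:R].
have genE x : gen k x = raw (val x) by apply/ffunP=> y; rewrite !ffunE.
rewrite {2}/chess_d /lin_ext linear_sum big1 // => L _.
rewrite linearZ /= linear_sum /= (_ : \sum_(i < _) _ = 0) ?scaler0 //.
apply: etrans (@alternating_sum0 _ _ m.+1
  (fun i j => raw (omit j (omit i L))) _).
  apply: eq_bigr => i _; rewrite linearZ /= [chess_d _]lin_ext_gen scaler_sumr.
  by apply: eq_bigr => j _; rewrite scalerA -exprD genE.
by move=> i j /andP[ji _]; rewrite omit_omit.
Qed.

(** [k[S Omega_N^+]]: the [(m-1)]-chains of [Omega_N^+] placed in degree [m],
    with the same differential; for [N > 0] it vanishes in degrees [m >= N]. *)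
Definition SOmega : chainComplex k :=
  @ChainComplex k (fun m => freeMod k (placement N m))
    (fun m => @chess_d m) chess_dd.

End Chessboard.

(** * The complex Sym^(p) *)

Section Tensors.
Variable T : eqType.
Implicit Types (W V : seq T) (Z A B : seq (seq T)).

(** A word [W] stands for a noncommutative monomial, and a list of words
    [Z_0; ...; Z_q] for the tensor product of its entries. *)
Definition mdeg W : nat := (size W).-1.
Definition tdeg Z : nat := sumn (map mdeg Z).

(** A list of tensors stands for their formal sum; [[::]] is zero. *)
Definition cut_mono (i : int) W : seq (seq (seq T)) :=
  if (0 <= i < (mdeg W)%:Z)%R
  then [:: [:: take `|i|.+1 W; drop `|i|.+1 W]] else [::].

Fixpoint cut (i : int) Z : seq (seq (seq T)) :=
  if Z is W :: V then
    [seq X ++ V | X <- cut_mono i W]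
      ++ [seq W :: Y | Y <- cut (i - (mdeg W)%:Z) V]
  else [::].

Lemma cut_neg (i : int) Z : (i < 0)%R -> cut i Z = [::].
Proof.
elim: Z i => [|W V IH] i i0 //=.
rewrite /cut_mono leNgt i0 /= IH //.
by rewrite ltrBlDr (lt_le_trans i0) // add0r.
Qed.

Lemma cut_cons (i : nat) W Z : cut i (W :: Z) =
  if (i < mdeg W)%N then [:: [:: take i.+1 W, drop i.+1 W & Z]]
  else [seq W :: Y | Y <- cut (i - mdeg W)%N Z].
Proof.
rewrite /= /cut_mono /= ltz_nat; case: ltnP => [lt|le] /=.
  by rewrite cut_neg // subr_lt0 ltz_nat.
by rewrite subzn.
Qed.

Lemma cut_cat (i : int) A B : cut i (A ++ B) =
  [seq X ++ B | X <- cut i A] ++ [seq A ++ Y | Y <- cut (i - (tdeg A)%:Z) B].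
Proof.
elim: A i => [|W A IH] i /=; first by rewrite subr0 map_id.
rewrite IH !map_cat -!map_comp -catA; congr (_ ++ _ ++ _).
  by apply: eq_map => X /=; rewrite catA.
by rewrite [tdeg _]/= PoszD opprD addrA.
Qed.

Lemma cut_ge (i : nat) Z : (tdeg Z <= i)%N -> cut i Z = [::].
Proof.
elim: Z i => [|W Z IH] i // le; rewrite cut_cons ltnNge.
by rewrite (leq_trans (leq_addr _ _) le) /= IH // leq_subRL // (leq_trans (leq_addr _ _) le).
Qed.

Lemma mdeg_take i W : (i < mdeg W)%N -> mdeg (take i.+1 W) = i.
Proof. by rewrite /mdeg size_take_min; lia. Qed.

Lemma mdeg_drop i W : mdeg (drop i.+1 W) = (mdeg W - i.+1)%N.
Proof. by rewrite /mdeg size_drop; lia. Qed.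

Lemma cut_cut (i j : nat) Z : (j < i)%N ->
  flatten [seq cut j Y | Y <- cut i Z] = flatten [seq cut i.-1 Y | Y <- cut j Z].
Proof.
have consE (l : nat) W s : (mdeg W <= l)%N ->
    flatten [seq cut l Y | Y <- [seq W :: X | X <- s]] =
    [seq W :: X | X <- flatten [seq cut (l - mdeg W)%N Y | Y <- s]].
  move=> dl; elim: s => // Y s IHs.
  by rewrite !map_cons [LHS]/= -/(cut l (W :: Y)) IHs cut_cons ltnNge dl /= map_cat.
elim: Z i j => [|W Z IH] i j ji //; rewrite !cut_cons.
have [id|di] := ltnP i (mdeg W).
  have jd := ltn_trans ji id; rewrite jd /= -!/(cut _ (_ :: _)) !cats0.
  rewrite !cut_cons mdeg_take // ji mdeg_take // ifF; last by lia.
  rewrite mdeg_drop ifT /=; last by lia.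
  rewrite take_takel 1?leqW // take_drop drop_drop.
  have -> : ((i.-1 - j).+1 + j.+1 = i.+1)%N by lia.
  by [].
have [jd|dj] := ltnP j (mdeg W).
  rewrite [RHS]/= -/(cut _ (_ :: _)) cats0 cut_cons mdeg_take // ifF; last by lia.
  rewrite cut_cons mdeg_drop ifF; last by lia.
  have -> : (i.-1 - j - (mdeg W - j.+1) = i - mdeg W)%N by lia.
  elim: (cut _ Z) => // Y s IHs.
  by rewrite !map_cons /= -/(cut _ (_ :: _)) cut_cons jd IHs.
rewrite !consE //; last by lia.
by rewrite IH; [congr (map _ (flatten (map (cut (Posz _)) _))); lia | lia].
Qed.

End Tensors.

Section Epi.
Variable p : nat.

(** [is_epi i] recognises the elements of Epi([p], [p - i]), for [i <= p]. *)
Definition is_epi (i : nat) (Z : seq (seq 'I_p.+1)) : bool :=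
  [&& (i <= p)%N, size Z == (p - i).+1, all (fun W => W != [::]) Z
    & perm_eq (flatten Z) (enum 'I_p.+1)].

Record Epi (i : nat) := MkEpi {
  epi_val :> seq (seq 'I_p.+1);
  epiP : is_epi i epi_val
}.
HB.instance Definition _ i := [isSub for @epi_val i].
HB.instance Definition _ i := [Choice of Epi i by <:].

Let words := {bseq p.+1 of {bseq p.+1 of 'I_p.+1}}.
Definition epi_code i (Z : Epi i) : words :=
  @insub_bseq _ _ (map (@insub_bseq _ _) (val Z)).
Definition epi_decode i (B : words) : option (Epi i) :=
  insub [seq (val W : seq _) | W <- val B].
Fact epi_codeK i : pcancel (@epi_code i) (@epi_decode i).
Proof.
move=> Z; have /and4P[ip /eqP sZ _ pZ] := epiP Z.
have sW W : W \in val Z -> (size W <= p.+1)%N.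
  move=> WZ; rewrite -[leqRHS]card_ord cardE -(perm_size pZ) size_flatten.
  by rewrite sumnE big_map (big_rem W) //= leq_addr.
rewrite /epi_decode /epi_code val_insubd size_map ifT ?sZ; last by lia.
rewrite -map_comp map_id_in ?valK // => W /sW lW.
by rewrite /= val_insubd lW.
Qed.
HB.instance Definition _ i := Countable.copy (Epi i) (pcan_type (@epi_codeK i)).
HB.instance Definition _ i : isFinite (Epi i) := PCanIsFinite (@epi_codeK i).

(** No term of [cut i Z] is lost when passing back to the type [Epi n]. *)
Lemma is_epi_cut n (i : int) Z : is_epi n.+1 Z -> all (is_epi n) (cut i Z).
Proof.
move=> /and4P[np /eqP sZ nZ pZ].
suff cutP Y : Y \in cut i Z ->
    [/\ size Y = (size Z).+1, all (fun W => W != [::]) Y & flatten Y = flatten Z].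
  apply/allP => Y /cutP[sY nY fY].
  by rewrite /is_epi sY sZ nY fY pZ andbT; lia.
elim: Z i Y {sZ pZ} nZ => [|W Z IH] i Y //= /andP[W0 nZ].
rewrite mem_cat => /orP[/mapP[X]|/mapP[X /IH[] // sX nX fX ->]]; last first.
  by rewrite /= sX W0 nX fX.
rewrite /cut_mono; case: ifP => // /andP[i0]; rewrite -{1}(gez0_abs i0) ltz_nat.
move: `|i|%N => j; rewrite /mdeg inE => jW /eqP-> ->; split=> //=.
  by rewrite nZ -!size_eq0 size_take_min size_drop !andbT; lia.
by rewrite catA cat_take_drop.
Qed.

End Epi.

Section Sym.
Variables (k : pzRingType) (p : nat).
Local Notation kEpi i := (freeMod k (Epi p i)).

Inductive sym_rel (i : nat) : kEpi i -> Prop :=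
| SymRel (A B : seq (seq 'I_p.+1)) (W V : seq 'I_p.+1) (Z Z' : Epi p i) :
    epi_val Z = A ++ [:: W, V & B] -> epi_val Z' = A ++ [:: V, W & B] ->
    sym_rel (gen k Z - (-1) ^+ (mdeg W * mdeg V) *: gen k Z').

Definition Sym_obj (i : nat) : lmodType k := lquot (span (@sym_rel i)).

Definition epi_d (n : nat) : kEpi n.+1 -> kEpi n :=
  lin_ext (fun Z : Epi p n.+1 => \sum_(i < n.+1)
    (-1) ^+ i *: \sum_(Y <- pmap insub (cut i%:Z (val Z))) gen k (Y : Epi p n)).
HB.instance Definition _ n := GRing.Linear.on (@epi_d n).

Definition raw n (Z : seq (seq 'I_p.+1)) : kEpi n := [ffun X => (epi_val X == Z)%:R].

Lemma gen_raw n (Z : Epi p n) : gen k Z = raw n (val Z).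
Proof. by apply/ffunP=> X; rewrite !ffunE. Qed.

Lemma sum_insub (V : nmodType) n (s : seq (seq (seq 'I_p.+1))) (f : seq (seq 'I_p.+1) -> V) :
  all (is_epi n) s ->
  \sum_(Y <- pmap insub s) f (val (Y : Epi p n)) = \sum_(Y <- s) f Y.
Proof.
elim: s => [|Y s IH] /=; first by rewrite !big_nil.
by case/andP=> Ye /IH IHs; rewrite insubT /= !big_cons IHs.
Qed.

Definition cut_sum (V : lmodType k) (Z : seq (seq 'I_p.+1)) (f : seq (seq 'I_p.+1) -> V) : V :=
  \sum_(i < tdeg Z) (-1) ^+ i *: \sum_(Y <- cut i%:Z Z) f Y.

Lemma tdeg_epi n (Z : seq (seq 'I_p.+1)) : is_epi n Z -> tdeg Z = n.
Proof.
case/and4P=> np /eqP sZ nZ /perm_size; rewrite -cardE card_ord.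
have -> : size (flatten Z) = (tdeg Z + size Z)%N.
  elim: Z {sZ} nZ => //= W Z IH /andP[W0 /IH]; rewrite size_cat => ->.
  by case: W W0 => //= x W _; rewrite /tdeg /= /mdeg /=; lia.
lia.
Qed.

Lemma epi_d_gen n (Z : Epi p n.+1) : epi_d (gen k Z) = cut_sum (val Z) (raw n).
Proof.
rewrite /epi_d lin_ext_gen /cut_sum (tdeg_epi (epiP Z)).
apply: eq_bigr => i _; congr (_ *: _).
under eq_bigr do rewrite gen_raw.
by rewrite sum_insub // is_epi_cut // epiP.
Qed.

Lemma cut_sum_cat (V : lmodType k) A B (f : seq (seq 'I_p.+1) -> V) :
  cut_sum (A ++ B) f = cut_sum A (fun X => f (X ++ B))
    + (-1) ^+ tdeg A *: cut_sum B (fun Y => f (A ++ Y)).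
Proof.
rewrite /cut_sum.
have -> : tdeg (A ++ B) = (tdeg A + tdeg B)%N by rewrite /tdeg map_cat sumn_cat.
rewrite big_split_ord /= scaler_sumr; congr (_ + _); apply: eq_bigr => i _.
  rewrite cut_cat [cut (_ - _) B]cut_neg ?subr_lt0 ?ltz_nat //= cats0.
  by rewrite big_map.
rewrite scalerA -exprD cut_cat [cut _ A]cut_ge ?leq_addr //= big_map.
by rewrite PoszD addrAC subrr add0r.
Qed.

Lemma cut_sum_mem (V : lmodType k) (S : submodClosed V) Z (f : seq (seq 'I_p.+1) -> V) :
  (forall i X, (i < tdeg Z)%N -> X \in cut i%:Z Z -> f X \in S) -> cut_sum Z f \in S.
Proof.
move=> fS; rewrite /cut_sum rpred_sum // => i _; rewrite rpredZ //.
by rewrite big_seq rpred_sum // => X; apply: fS.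
Qed.

Lemma cut_sumB (V : lmodType k) Z (f g : seq (seq 'I_p.+1) -> V) (c : k) m :
  c = (-1) ^+ m ->
  cut_sum Z f - c *: cut_sum Z g = cut_sum Z (fun X => f X - c *: g X).
Proof.
move=> ->; rewrite /cut_sum scaler_sumr -sumrB; apply: eq_bigr => i _.
by rewrite scalerA -exprD addnC exprD -scalerA -scalerBr scaler_sumr -sumrB.
Qed.

Lemma raw_swap n A W V B :
  raw n (A ++ [:: W, V & B]) - (-1) ^+ (mdeg W * mdeg V) *: raw n (A ++ [:: V, W & B])
    \in span (@sym_rel n).
Proof.
have eE : is_epi n (A ++ [:: V, W & B]) = is_epi n (A ++ [:: W, V & B]).
  rewrite /is_epi !size_cat /= !all_cat /= (andbCA (V != [::])).
  congr [&& _, _, _ & _].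
  have /permPl-> // : perm_eq (flatten (A ++ [:: V, W & B]))
                              (flatten (A ++ [:: W, V & B])).
  by rewrite !flatten_cat /= perm_cat2l perm_catCA.
case: (boolP (is_epi n (A ++ [:: W, V & B]))) => eZ.
  have eZ' : is_epi n (A ++ [:: V, W & B]) by rewrite eE.
  have := @SymRel n A B W V (MkEpi eZ) (MkEpi eZ') erefl erefl.
  by rewrite !gen_raw; apply: span_gen.
have raw0 Y : ~~ is_epi n Y -> raw n Y = 0.
  move=> nY; apply/ffunP => X; rewrite !ffunE; case: eqP => // XY.
  by case/negP: nY; rewrite -XY epiP.
by rewrite !raw0 ?eE // scaler0 subr0 rpred0.
Qed.

Lemma sign_parity (m1 m2 : nat) :
  odd m1 = odd m2 -> (-1) ^+ m1 = (-1) ^+ m2 :> k.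
Proof. by move=> e; rewrite -signr_odd e signr_odd. Qed.

Lemma koszul_swap (U V : lmodType k) (f : {linear U -> V})
    (x x' y y' z z' t t' : U) (a v w : nat) :
  f x = (-1) ^+ (w * v) *: f x' -> f y = (-1) ^+ (w * v + v) *: f y' ->
  f z = (-1) ^+ (w * v + w) *: f z' -> f t = (-1) ^+ (w * v) *: f t' ->
  f (x + (-1) ^+ a *: (y + (-1) ^+ w *: (z + (-1) ^+ v *: t))) =
  f ((-1) ^+ (w * v) *:
     (x' + (-1) ^+ a *: (z' + (-1) ^+ v *: (y' + (-1) ^+ w *: t')))).
Proof.
move=> fx fy fz ft; rewrite !(linearD, linearZ) /= fx fy fz ft.
rewrite !scalerDr !scalerA -!exprD; congr (_ + _).
rewrite addrCA; congr (_ *: _ + (_ *: _ + _ *: _)); apply: sign_parity;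
  by rewrite !oddD; case: (odd (w * v)) (odd a) (odd v) (odd w) => [] [] [] [].
Qed.

Lemma epi_d_rel n v : v \in span (@sym_rel n.+1) -> epi_d v \in span (@sym_rel n).
Proof.
set S := span (@sym_rel n).
move=> /asboolP; elim=> [|a _ u [A B W V Z Z' eZ eZ'] _ IH].
  by rewrite linear0 rpred0.
rewrite linearP /= rpredD // rpredZ //= {a u IH}.
rewrite linearB linearZ /= !epi_d_gen.
change (val Z) with (epi_val Z); change (val Z') with (epi_val Z').
rewrite eZ eZ' {Z Z' eZ eZ'}.
rewrite -[[:: W, V & B]]/([:: W] ++ [:: V] ++ B).
rewrite -[[:: V, W & B]]/([:: V] ++ [:: W] ++ B).
have tdeg1 (U : seq 'I_p.+1) : tdeg [:: U] = mdeg U by rewrite /tdeg /= addn0.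
rewrite !cut_sum_cat !tdeg1.
set w := mdeg W; set v' := mdeg V.
have swapP A' W' V' B' :
    lquot_pi S (raw n (A' ++ [:: W', V' & B'])) =
    (-1) ^+ (mdeg W' * mdeg V') *: lquot_pi S (raw n (A' ++ [:: V', W' & B'])).
  by rewrite -linearZ; apply/lquot_piP; apply: raw_swap.
have sumP C f g m :
    (forall i X, (i < tdeg C)%N -> X \in cut i%:Z C ->
       lquot_pi S (f X) = (-1) ^+ m *: lquot_pi S (g X)) ->
    lquot_pi S (cut_sum C f) = (-1) ^+ m *: lquot_pi S (cut_sum C g).
  move=> fg; rewrite -linearZ; apply/lquot_piP.
  rewrite (@cut_sumB _ _ _ _ _ m) //; apply: cut_sum_mem => i X iC XC.
  by apply/lquot_piP; rewrite linearZ (fg i).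
have cut1P (U : seq 'I_p.+1) i X : (i < tdeg [:: U])%N -> X \in cut i%:Z [:: U] ->
    exists P Q, X = [:: P; Q] /\ (mdeg P + mdeg Q).+1 = mdeg U.
  rewrite tdeg1 cut_cons => iU; rewrite iU inE => /eqP->.
  exists (take i.+1 U), (drop i.+1 U); split=> //.
  by rewrite mdeg_take // mdeg_drop; lia.
have pS (x y : freeMod k (Epi p n)) :
    lquot_pi S x = lquot_pi S y -> x - y \in S by move/lquot_piP.
apply: pS; apply: koszul_swap.
- by apply: sumP => i X _ _; apply: swapP.
- apply: sumP => i X iW /cut1P[] // P [Q [-> dPQ]] /=.
  have := swapP (A ++ [:: P]) Q V B; rewrite -!catA /= => ->.
  rewrite (swapP A P V) scalerA -exprD; congr (_ *: _); apply: sign_parity.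
  by rewrite -/v' (_ : w = (mdeg P + mdeg Q).+1); [lia | rewrite dPQ].
- apply: sumP => i X iV /cut1P[] // P [Q [-> dPQ]] /=.
  rewrite (swapP A W P).
  have := swapP (A ++ [:: P]) W Q B; rewrite -!catA /= => ->.
  rewrite scalerA -exprD; congr (_ *: _); apply: sign_parity.
  by rewrite -/w (_ : v' = (mdeg P + mdeg Q).+1); [lia | rewrite dPQ].
- by apply: sumP => i X _ _; apply: swapP.
Qed.

Lemma epi_dd n v : @epi_d n (@epi_d n.+1 v) = 0.
Proof.
apply: (@linear_gen0 _ _ _ (@epi_d n \o @epi_d n.+1)) => {v} Z.
rewrite [LHS]/= epi_d_gen /cut_sum linear_sum (tdeg_epi (epiP Z)).
apply: etrans (@alternating_sum0 _ _ n.+1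
  (fun i j => \sum_(X <- flatten [seq cut j Y | Y <- cut i (val Z)]) raw n X) _).
  apply: eq_bigr => i _; rewrite linearZ /= linear_sum /=.
  have cE := is_epi_cut i (epiP Z).
  rewrite -(sum_insub (fun Y => epi_d (raw n.+1 Y)) cE).
  have -> : \sum_(Y <- pmap insub (cut i (val Z)))
      epi_d (raw n.+1 (val (Y : Epi p n.+1))) =
    \sum_(Y <- pmap insub (cut i (val Z))) \sum_(j < n.+1) (-1) ^+ j *:
      \sum_(X <- cut j (val (Y : Epi p n.+1))) raw n X.
    by apply: eq_bigr => Y _; rewrite -gen_raw epi_d_gen /cut_sum (tdeg_epi (epiP Y)).
  rewrite exchange_big /= scaler_sumr; apply: eq_bigr => j _.
  rewrite -scaler_sumr scalerA -exprD; congr (_ *: _).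
  rewrite (sum_insub (fun Y => \sum_(X <- cut j Y) raw n X) cE).
  by rewrite big_flatten big_map.
by move=> i j /andP[ji _]; rewrite cut_cut.
Qed.

Definition Sym_d (n : nat) : Sym_obj n.+1 -> Sym_obj n :=
  @lquot_map k _ _ (span (@sym_rel n.+1)) (span (@sym_rel n)) (@epi_d n).
HB.instance Definition _ n := GRing.isLinear.Build k (Sym_obj n.+1) (Sym_obj n) _
  (@Sym_d n) (lquot_map_linear (@epi_d_rel n)).

Fact Sym_dd n x : @Sym_d n (@Sym_d n.+1 x) = 0.
Proof.
rewrite -[x]lquot_reprK /Sym_d.
rewrite (lquot_mapE (@epi_d_rel n.+1)) (lquot_mapE (@epi_d_rel n)).
apply: etrans (linear0 (lquot_pi (span (@sym_rel n)))).
by congr (lquot_pi _ _); apply: epi_dd.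
Qed.

(** [Sym^(p)], which vanishes in degrees [> p] since [Epi p i] is then empty. *)
Definition Sym : chainComplex k :=
  @ChainComplex k Sym_obj (fun n => @Sym_d n) Sym_dd.

End Sym.

(* Main.v *)
From HB Require Import structures.
Require Import Defs.
From mathcomp Require Import all_boot all_order all_algebra.
From mathcomp Require Import zify boolp.

(** A cycle-free placement of rooks on the board indexed by [{0, ..., p}] is the
    arc set [i -> j] of a directed graph in which every vertex has at most one
    outgoing and at most one incoming arc and which has no cycle.  Such a graph
    is a disjoint union of paths, and a path spells a nonempty word without
    repeated letters.  So a placement of [n] rooks is the same thing as an
    unordered family of [p + 1 - n] words using each of the [p + 1] letters
    once, that is, a generator of [Sym_n] up to the order of its factors
    ([tensor_of_arcs], [arcs_perm_inj]).

    The signs match as in an exterior algebra.  A tensor [Z] lists its arcs in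
    a definite order, [arcs Z]; moving a word past its neighbour moves a block
    of [deg] arcs past another block, which is the Koszul sign of the relation
    defining [Sym].  On the other side a placement lists its arcs by increasing
    row.  The sign of the permutation comparing the two lists, [orientation Z],
    is [-1] to the number of inversions of the row numbers of [arcs Z].
    Multiplied by it, a tensor has a class in [Sym] that depends only on its
    set of arcs ([oriented_arcs]), and [omega] sends a placement to this class.

    The boundary [\partial_i] deletes the [i]-th arc of a tensor ([cut_arcs]),
    and the [s]-th face of a placement deletes its [s]-th rook.  Deleting the
    same arc from two orderings of one set changes the comparing sign by the
    parity of the difference of its two positions ([inversions_omit_sorted]),
    so [omega] commutes with the differentials.  The inverse sends [Z] to
    [orientation Z] times the placement with arcs [arcs Z]. *)

Set Implicit Arguments.
Unset Strict Implicit.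
Unset Printing Implicit Defensive.

Import GRing.Theory.
Local Open Scope ring_scope.

(** * Lists *)

Lemma omit_cat (T : eqType) i (s t : seq T) :
  omit i (s ++ t) =
  if (i < size s)%N then omit i s ++ t else s ++ omit (i - size s) t.
Proof.
rewrite /omit take_cat drop_cat; case: ltnP => [lt|ge].
  case: ltnP => [_|ge]; first by rewrite catA.
  have e : i.+1 = size s by apply/eqP; rewrite eqn_leq lt ge.
  by rewrite -e subnn drop0 e drop_size cats0.
by rewrite ltnNge leqW //= subSn // catA.
Qed.

Lemma omit_size (T : eqType) (s : seq T) x t :
  omit (size s) (s ++ x :: t) = s ++ t.
Proof. by rewrite omit_cat ltnn subnn /omit take0 /= drop0. Qed.

(** Adjacent transpositions generate all permutations. *)
Lemma perm_adjacent_eq (T : eqType) (U : Type) (F : seq T -> U) :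
  (forall A x y B, F (A ++ [:: x, y & B]) = F (A ++ [:: y, x & B])) ->
  forall s t, perm_eq s t -> F s = F t.
Proof.
move=> Fswap s t.
suff main A : perm_eq s t -> F (A ++ s) = F (A ++ t) by apply: (main [::]).
elim: s t A => [|x s IH] t A st.
  by move: st; rewrite perm_sym => /perm_nilP->.
have : x \in t by rewrite -(perm_mem st) mem_head.
move=> xt; case/splitPr: xt st => t1 t2 st.
have move_front B : F (B ++ t1 ++ x :: t2) = F (B ++ x :: t1 ++ t2).
  elim: t1 B {st} => [|y t1 IHt] B //=.
  by have := IHt (rcons B y); rewrite !cat_rcons Fswap.
rewrite move_front -!(cat_rcons x); apply: IH.
by move: st; rewrite perm_sym (perm_catCA t1 [:: x]) /= perm_cons perm_sym.
Qed.

(** * The arcs of a tensor *)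

Section Arcs.
Variable T : eqType.
Implicit Types (W : seq T) (Z : seq (seq T)) (E : seq (T * T)).

Definition word_arcs W : seq (T * T) := zip W (behead W).
Definition arcs Z : seq (T * T) := flatten [seq word_arcs W | W <- Z].

Lemma size_word_arcs W : size (word_arcs W) = mdeg W.
Proof. by rewrite size_zip size_behead /mdeg; lia. Qed.

Lemma size_arcs Z : size (arcs Z) = tdeg Z.
Proof.
rewrite size_flatten /shape -map_comp; congr sumn.
by apply: eq_map => W; apply: size_word_arcs.
Qed.

(** Read from left to right, this is how [tensor_of_arcs] glues words along a
    new arc; read from right to left, how [cut_arcs] deletes an arc. *)
Lemma word_arcs_cat A x y B :
  word_arcs (rcons A x ++ y :: B) =
  word_arcs (rcons A x) ++ (x, y) :: word_arcs (y :: B).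
Proof.
elim: A => [|a A IH] //; case: A IH => [|a' A] // IH.
by rewrite !rcons_cons !cat_cons /word_arcs /= -[zip _ _]/(word_arcs _) IH.
Qed.

Lemma arcs_cons W Z : arcs (W :: Z) = word_arcs W ++ arcs Z.
Proof. by []. Qed.

Lemma arcs_cat Z Z' : arcs (Z ++ Z') = arcs Z ++ arcs Z'.
Proof. by rewrite /arcs map_cat flatten_cat. Qed.

Lemma perm_arcs Z Z' : perm_eq Z Z' -> perm_eq (arcs Z) (arcs Z').
Proof. by move=> ZZ'; apply/perm_flatten/perm_map. Qed.

(** The offset [i - deg W] in the definition of [\partial_i] on a tensor counts
    arcs, so that [\partial_i] cuts exactly at the [i]-th arc, and it vanishes
    only when there is no such arc. *)
Lemma cut_arcs i Z : (i < tdeg Z)%N ->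
  exists2 Y, cut i%:Z Z = [:: Y] & arcs Y = omit i (arcs Z).
Proof.
elim: Z i => [|W Z IH] i //; rewrite cut_cons arcs_cons omit_cat.
rewrite size_word_arcs => itd; case: (ltnP i (mdeg W)) => [iW|Wi]; last first.
  have [|Y -> arcsY] := IH (i - mdeg W)%N; first by move: itd; rewrite /tdeg /=; lia.
  by exists (W :: Y); rewrite // arcs_cons arcsY.
exists [:: take i.+1 W, drop i.+1 W & Z] => //; rewrite !arcs_cons catA; congr (_ ++ _).
have sT : size (take i.+1 W) = i.+1 by move: iW; rewrite size_take_min /mdeg; lia.
have sD : (0 < size (drop i.+1 W))%N by move: iW; rewrite size_drop /mdeg; lia.
rewrite -{3}(cat_take_drop i.+1 W).
case/lastP: (take _ _) sT => [|A x] // sA.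
case: (drop _ _) sD => [|y B] // _; rewrite word_arcs_cat.
have -> : i = size (word_arcs (rcons A x)) by rewrite size_word_arcs /mdeg sA.
by rewrite omit_size.
Qed.

Lemma perm_flatten_split (f g h : seq T -> seq T) Z :
  (forall W, h W = f W ++ g W) ->
  perm_eq (flatten (map h Z)) (flatten (map f Z) ++ flatten (map g Z)).
Proof.
move=> hE; elim: Z => //= W Z IH.
by rewrite hE (perm_trans _ (permEl (perm_catACA _ _ _ _))) // perm_cat2l.
Qed.

(** The first, respectively last, letters of the words; [take] and [drop] make
    an empty word contribute nothing, which avoids a default letter. *)
Definition heads Z := flatten (map (take 1) Z).
Definition lasts Z := flatten [seq drop (mdeg W) W | W <- Z].

Lemma unzip1_arcs Z : unzip1 (arcs Z) = flatten [seq take (mdeg W) W | W <- Z].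
Proof.
rewrite /unzip1 map_flatten -map_comp; congr flatten; apply: eq_map => W /=.
elim: W => [|x [|y W] IH] //=; rewrite /word_arcs /= in IH *.
by rewrite IH.
Qed.

Lemma unzip2_arcs Z : unzip2 (arcs Z) = flatten [seq behead W | W <- Z].
Proof.
rewrite /unzip2 map_flatten -map_comp; congr flatten; apply: eq_map => W /=.
by rewrite -/(unzip2 _) unzip2_zip // size_behead leq_pred.
Qed.

(** Within a word, each letter but the first is the target of one arc, and
    each letter but the last is the source of one arc.  All that is used about
    rows, columns and ends of words follows from this and from [perm_lasts]. *)
Lemma perm_heads Z : perm_eq (flatten Z) (heads Z ++ unzip2 (arcs Z)).
Proof.
rewrite unzip2_arcs -{1}[Z]map_id; apply: perm_flatten_split => W.
by rewrite -drop1 cat_take_drop.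
Qed.

Lemma perm_lasts Z : perm_eq (flatten Z) (unzip1 (arcs Z) ++ lasts Z).
Proof.
rewrite unzip1_arcs -{1}[Z]map_id; apply: perm_flatten_split => W.
by rewrite cat_take_drop.
Qed.

Lemma mem_heads x Z : reflect (exists s, x :: s \in Z) (x \in heads Z).
Proof.
apply: (iffP flatten_mapP) => [[[|y W] // WZ]|[s sZ]].
  by rewrite /= take0 inE => /eqP->; exists W.
by exists (x :: s); rewrite //= take0 mem_head.
Qed.

Lemma mem_lasts x Z : reflect (exists s, rcons s x \in Z) (x \in lasts Z).
Proof.
have dropE y s : drop (mdeg (rcons s y)) (rcons s y) = [:: y].
  by rewrite /mdeg size_rcons -cats1 drop_size_cat.
apply: (iffP flatten_mapP) => [[W]|[s sZ]]; last first.
  by exists (rcons s x); rewrite ?dropE ?inE.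
by case/lastP: W => [|W y] // WZ; rewrite dropE inE => /eqP->; exists W.
Qed.

(** * Words as maximal paths *)

Section Uniq.
Variable Z : seq (seq T).
Hypothesis Zuniq : uniq (flatten Z).

Lemma uniq_heads : uniq (heads Z ++ unzip2 (arcs Z)).
Proof. by rewrite -(perm_uniq (perm_heads Z)). Qed.

Lemma uniq_lasts : uniq (unzip1 (arcs Z) ++ lasts Z).
Proof. by rewrite -(perm_uniq (perm_lasts Z)). Qed.

Lemma uniq_rows_arcs : uniq (unzip1 (arcs Z)).
Proof. by have := uniq_lasts; rewrite cat_uniq => /andP[]. Qed.

Lemma uniq_cols_arcs : uniq (unzip2 (arcs Z)).
Proof. by have := uniq_heads; rewrite cat_uniq => /and3P[]. Qed.

Lemma heads_cols x : x \in flatten Z -> (x \in heads Z) = (x \notin unzip2 (arcs Z)).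
Proof.
rewrite (perm_mem (perm_heads Z)) mem_cat.
have := uniq_heads; rewrite cat_uniq => /and3P[_ /hasPn dis _].
by have := dis x; do 2 case: (x \in _) => //; move/(_ isT).
Qed.

Lemma lasts_rows x : x \in flatten Z -> (x \in lasts Z) = (x \notin unzip1 (arcs Z)).
Proof.
rewrite (perm_mem (perm_lasts Z)) mem_cat.
have := uniq_lasts; rewrite cat_uniq => /and3P[_ /hasPn dis _].
by have := dis x; do 2 case: (x \in _) => //; move/(_ isT).
Qed.

End Uniq.

Lemma subset_word_arcs W Z : W \in Z -> {subset word_arcs W <= arcs Z}.
Proof. by move=> WZ e eW; apply/flatten_mapP; exists W. Qed.

Lemma subseq_flatten W Z : W \in Z -> subseq W (flatten Z).
Proof.
by case/splitPr=> Z1 Z2; rewrite flatten_cat /=; apply: subseq_trans (suffix_subseq _ _);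
  apply: prefix_subseq.
Qed.

Lemma path_word_arcs E x s :
  path [rel a b | (a, b) \in E] x s = all (mem E) (word_arcs (x :: s)).
Proof. by elim: s x => [|y s IH] x //=; rewrite IH. Qed.

Lemma arcs_functional E x y y' : uniq (unzip1 E) ->
  (x, y) \in E -> (x, y') \in E -> y = y'.
Proof.
elim: E => [|[a b] E IH] //= /andP[aE uE]; rewrite !inE.
have notE z : (a, z) \in E -> False.
  by move=> azE; case/negP: aE; apply/mapP; exists (a, z).
move=> /predU1P[[xa yb]|xyE] /predU1P[[xa' yb']|xy'E]; last exact: IH.
- by rewrite yb yb'.
- by rewrite xa in xy'E; case: (notE _ xy'E).
- by rewrite xa' in xyE; case: (notE _ xyE).
Qed.

(** Each vertex has at most one successor, so two paths from [x] agree until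
    one of them stops, and a path that cannot be prolonged does not stop
    first. *)
Lemma maximal_path_unique E x s t : uniq (unzip1 E) ->
  path [rel a b | (a, b) \in E] x s -> path [rel a b | (a, b) \in E] x t ->
  last x s \notin unzip1 E -> last x t \notin unzip1 E -> s = t.
Proof.
move=> uE; have rowE a b : (a, b) \in E -> a \in unzip1 E.
  by move=> abE; apply/mapP; exists (a, b).
elim: s x t => [|y s IH] x [|z t] //=.
- by move=> _ /andP[/rowE xE _] /negP[].
- by move=> /andP[/rowE xE _] _ _ /negP[].
move=> /andP[xy ys] /andP[xz zt] ls lt.
have e := arcs_functional uE xy xz; rewrite -{}e in zt lt *.
by congr cons; apply: IH lt.
Qed.

(** The first letter of a word [W] of [Z] is not the target of an arc, so it also
    begins a word of [Z'].  Both words are then maximal paths of the same graph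
    with the same origin. *)
Lemma arcs_subset_words Z Z' :
  uniq (flatten Z) -> uniq (flatten Z') -> [::] \notin Z ->
  {subset flatten Z <= flatten Z'} -> arcs Z =i arcs Z' -> {subset Z <= Z'}.
Proof.
move=> uZ uZ' nZ sub eqA [|x s] WZ; first by rewrite WZ in nZ.
have xW : x \in flatten Z by apply: mem_subseq (subseq_flatten WZ) _ (mem_head x s).
have x0 : x \in heads Z by apply/mem_heads; exists s.
rewrite heads_cols // (eq_mem_map _ eqA) -heads_cols ?sub // in x0.
case/mem_heads: x0 => t tZ'.
suff -> : s = t by [].
have uE := uniq_rows_arcs uZ'.
apply: (maximal_path_unique uE) (_ : path _ x _) _ _ _.
- by rewrite path_word_arcs; apply/allP => e /(subset_word_arcs WZ); rewrite eqA.
- by rewrite path_word_arcs; apply/allP => e /(subset_word_arcs tZ').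
- rewrite -(eq_mem_map _ eqA) -lasts_rows //.
    by apply/mem_lasts; exists (belast x s); rewrite -lastI.
  exact: mem_subseq (subseq_flatten WZ) _ (mem_last x s).
- rewrite -lasts_rows //; last exact: mem_subseq (subseq_flatten tZ') _ (mem_last x t).
  by apply/mem_lasts; exists (belast x t); rewrite -lastI.
Qed.

Lemma uniq_words Z : [::] \notin Z -> uniq (flatten Z) -> uniq Z.
Proof.
elim: Z => //= W Z IH; rewrite inE negb_or cat_uniq => /andP[W0 nZ].
case/and3P=> _ /hasPn dis /(IH nZ)->; rewrite andbT.
case: W W0 dis => [|x W] // _ dis; apply/negP => WZ.
have xZ := mem_subseq (subseq_flatten WZ) (mem_head x W).
by have := dis x xZ; rewrite mem_head.
Qed.

Lemma arcs_perm_inj Z Z' :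
  uniq (flatten Z) -> [::] \notin Z -> [::] \notin Z' ->
  perm_eq (flatten Z) (flatten Z') -> perm_eq (arcs Z) (arcs Z') -> perm_eq Z Z'.
Proof.
move=> uZ nZ nZ' eqF eqA; have uZ' := uZ; rewrite (perm_uniq eqF) in uZ'.
apply: uniq_perm; rewrite ?uniq_words // => W.
apply/idP/idP; apply: arcs_subset_words => // x;
  by rewrite ?(perm_mem eqF) ?(perm_mem eqA).
Qed.

Lemma mem_arcs_flatten Z a b : (a, b) \in arcs Z ->
  exists A B, flatten Z = A ++ [:: a, b & B].
Proof.
elim: Z => //= W Z IH; rewrite /arcs /= mem_cat => /orP[abW|/IH[A [B ->]]]; last first.
  by exists (W ++ A), B; rewrite catA.
suff [A [B ->]] : exists A B, W = A ++ [:: a, b & B].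
  by exists A, (B ++ flatten Z); rewrite -catA.
elim: W abW {IH} => [|x [|y W] IH] //.
rewrite [word_arcs _]/= inE => /orP[/eqP[-> ->]|/IH[A [B ->]]].
  by exists [::], W.
by exists (x :: A), B.
Qed.

(** This is why the arcs of words contain no cycle: along a cycle, the position
    in the concatenated word would increase at every step. *)
Lemma index_arcs Z a b : uniq (flatten Z) -> (a, b) \in arcs Z ->
  (index a (flatten Z) < index b (flatten Z))%N.
Proof.
move=> uZ /mem_arcs_flatten[A [B eZ]]; move: uZ; rewrite eZ cat_uniq /=.
case/and3P=> _ /norP[aA /norP[bA _]] /andP[]; rewrite !inE => /norP[ab _] _.
by rewrite !index_cat (negPf aA) (negPf bA) /= !eqxx (negPf ab); lia.
Qed.

End Arcs.

Lemma cycle_free_arcs N (Z : seq (seq 'I_N)) :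
  uniq (flatten Z) -> cycle_free (arcs Z).
Proof.
move=> uZ; apply/existsP => -[[c _] /= /andP[]]; case: c => [|x c] // _ /andP[cyc _].
have /= := sub_path (e' := relpre (index^~ (flatten Z)) ltn) _ cyc.
move/(_ (fun a b => @index_arcs _ Z a b uZ)).
move/(order_path_min (fun _ _ _ => @ltn_trans _ _ _))/allP/(_ x).
by rewrite mem_rcons mem_head /= ltnn => /(_ isT).
Qed.

Lemma cycle_free_subset N (L L' : seq ('I_N * 'I_N)) :
  {subset L <= L'} -> cycle_free L' -> cycle_free L.
Proof.
move=> sub /cycle_freeP cf; apply/cycle_freeP => c c0 /(cf c c0).
by apply: contra; apply: sub_all => x; apply: sub.
Qed.

(** Induction on the number of arcs.  Given words for [L], the new arc [(x, y)]
    has its source [x] at the end of a word and its target [y] at the beginning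
    of one.  These are different words, since otherwise that word closed up by
    [(x, y)] would be a cycle; gluing them adds exactly the arc [(x, y)]. *)
Lemma tensor_of_arcs N (L : seq ('I_N * 'I_N)) :
  uniq (unzip1 L) -> uniq (unzip2 L) -> cycle_free L ->
  exists Z, [/\ [::] \notin Z, perm_eq (flatten Z) (enum 'I_N) & perm_eq (arcs Z) L].
Proof.
elim: L => [|[x y] L IH] /=.
  move=> _ _ _; exists [seq [:: i] | i <- enum 'I_N]; rewrite flatten_seq1; split=> //.
    by apply/negP => /mapP[].
  by rewrite /arcs -map_comp (_ : flatten _ = [::]) //; elim: (enum _).
case/andP=> xL uL1 /andP[yL uL2] cf.
have [|Z [nZ fZ aZ]] := IH uL1 uL2.
  by apply: cycle_free_subset cf => e eL; rewrite inE eL orbT.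
have uZ : uniq (flatten Z) by rewrite (perm_uniq fZ) enum_uniq.
have memZ i : i \in flatten Z by rewrite (perm_mem fZ) mem_enum.
have : x \in lasts Z by rewrite lasts_rows // (perm_mem (perm_map _ aZ)).
case/mem_lasts=> s sZ.
have : y \in heads Z by rewrite heads_cols // (perm_mem (perm_map _ aZ)).
case/mem_heads=> t tZ.
have neq : y :: t != rcons s x.
  (* A word [y ... x] together with the arc [(x, y)] is a cycle. *)
  apply/eqP => e.
  have /cycle_freeP/(_ (y :: t) isT) := cf.
  rewrite (subseq_uniq (subseq_flatten tZ) uZ) => /(_ isT)/negP[].
  have -> : zip (y :: t) (rot 1 (y :: t)) = rcons (word_arcs (y :: t)) (x, y).
    have lx : last y t = x by have := congr1 (last x) e; rewrite last_rcons.
    suff zipE w : zip (w :: t) (rcons t y) = rcons (zip (w :: t) t) (last w t, y).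
      by rewrite rot1_cons zipE lx.
    by elim: t w {e lx tZ} => //= z t IHt w; rewrite IHt.
  rewrite all_rcons; apply/andP; split; first exact: mem_head.
  apply/allP => a /(subset_word_arcs tZ).
  by rewrite (perm_mem aZ) /= inE => ->; rewrite orbT.
have p1 := perm_to_rem sZ; set Z1 := rem _ _ in p1.
have tZ1 : y :: t \in Z1 by move: tZ; rewrite (perm_mem p1) inE (negPf neq).
have p2 := perm_to_rem tZ1; set Z2 := rem _ _ in p2.
have {p1 p2}pZ : perm_eq Z [:: rcons s x, y :: t & Z2].
  by apply: perm_trans p1 _; rewrite perm_cons.
exists ((rcons s x ++ y :: t) :: Z2); split.
- rewrite inE negb_or; apply/andP; split; first by case: (s).
  by move: nZ; rewrite (perm_mem pZ) !inE !negb_or => /and3P[].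
- by rewrite (permPl (perm_flatten pZ)) in fZ; rewrite /= -catA.
- rewrite (permPl (perm_arcs pZ)) !arcs_cons in aZ.
  by rewrite arcs_cons word_arcs_cat -catA -cat1s -catA perm_catCA perm_cons.
Qed.

(** * Inversions *)

Section Inversions.
Local Open Scope nat_scope.
Implicit Types s t : seq nat.

(** The inversions of [s ++ t] between the two blocks. *)
Definition crossings s t : nat := \sum_(x <- s) \sum_(y <- t) (y < x).

Fixpoint inversions s : nat :=
  if s is x :: s' then crossings [:: x] s' + inversions s' else 0.

Lemma crossings_catl s1 s2 t :
  crossings (s1 ++ s2) t = crossings s1 t + crossings s2 t.
Proof. exact: big_cat. Qed.

Lemma crossings_catr s t1 t2 :
  crossings s (t1 ++ t2) = crossings s t1 + crossings s t2.
Proof. by rewrite -big_split /=; apply: eq_bigr => x _; rewrite big_cat. Qed.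

Lemma perm_crossings s t1 t2 : perm_eq t1 t2 -> crossings s t1 = crossings s t2.
Proof. by move=> tt; apply: eq_bigr => x _; apply: perm_big. Qed.

Lemma inversions_cat s t :
  inversions (s ++ t) = inversions s + inversions t + crossings s t.
Proof.
elim: s => [|x s IH] /=; first by rewrite /crossings big_nil addn0.
rewrite IH crossings_catr.
by rewrite -[crossings (x :: s) t]/(crossings ([:: x] ++ s) t) crossings_catl; lia.
Qed.

(** Of two different numbers exactly one order is inverted. *)
Lemma crossingsC s t : uniq (s ++ t) ->
  crossings s t + crossings t s = size s * size t.
Proof.
rewrite cat_uniq => /and3P[_ /hasPn dis _].
rewrite /crossings [X in _ + X]exchange_big -big_split /=.
transitivity (\sum_(x <- s) size t); last first.
  by rewrite big_const_seq iter_addn_0 count_predT mulnC.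
rewrite !big_seq; apply: eq_bigr => x xs; rewrite -big_split /=.
rewrite -[RHS]sum1_size !big_seq; apply: eq_bigr => y yt.
have : y != x by apply: contraNneq (dis y yt) => ->.
by case: ltngtP.
Qed.

(** The Koszul rule: exchanging two blocks of distinct numbers multiplies the
    sign by [-1] to the product of their lengths. *)
Lemma inversions_swap a s t b : uniq (s ++ t) ->
  odd (inversions (a ++ s ++ t ++ b)) =
  odd (size s * size t) (+) odd (inversions (a ++ t ++ s ++ b)).
Proof.
move=> /crossingsC st; rewrite !inversions_cat !crossings_catr -st.
lia.
Qed.

Lemma inversions_sorted s : sorted ltn s -> inversions s = 0.
Proof.
elim: s => //= x s IH xs; rewrite IH ?(path_sorted xs) // addn0.
rewrite /crossings big_seq1 big_seq big1 // => y ys.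
have /allP/(_ y ys) := order_path_min ltn_trans xs.
by move=> /ltnW; rewrite leqNgt => /negPf ->.
Qed.

(** Write [s = a ++ x :: b].  Deleting [x] loses the inversions of [x], namely
    the entries of [a] above [x] and the entries of [b] below [x].  As [i] is
    the length of [a], adding it replaces, modulo 2, the entries of [a] above
    [x] by those below [x].  The right-hand side only depends on the set of
    entries of [s], which lets one compare two orderings of the same set. *)
Lemma inversions_omit s i : uniq s -> i < size s ->
  odd (inversions s + inversions (omit i s) + i) = odd (crossings [:: nth 0 s i] s).
Proof.
move=> us ls; move: us.
rewrite -{1 2 5}(cat_take_drop i s) (drop_nth 0 ls) /omit.
have: size (take i s) = i by rewrite size_takel // ltnW.
move: (take i s) (nth 0 s i) (drop i.+1 s) => a x b <-.
rewrite -cat1s catA => us.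
have ux : uniq ([:: x] ++ a).
  by move: us; rewrite -catA uniq_catCA catA cat_uniq => /andP[].
have := crossingsC ux; rewrite mul1n => <-.
rewrite !inversions_cat !crossings_catl !crossings_catr /=.
rewrite /crossings !big_seq1 ltnn big_nil.
lia.
Qed.

(** In the sorted list [t] there are no inversions, before or after the
    deletion, so [inversions_omit] leaves the parity of the position [j]. *)
Lemma inversions_omit_sorted s t i j : uniq s -> sorted ltn t -> perm_eq s t ->
  i < size s -> j < size t -> nth 0 s i = nth 0 t j ->
  odd (inversions s + inversions (omit i s) + i) = odd j.
Proof.
move=> us st pst ls lt eij; rewrite inversions_omit // (perm_crossings _ pst) eij.
rewrite -inversions_omit -?(perm_uniq pst) // !inversions_sorted //.
by apply: subseq_sorted (omit_subseq _ _) st; apply: ltn_trans.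
Qed.

End Inversions.

(** * Placements and tensors *)

Definition row_numbers N (L : seq ('I_N * 'I_N)) : seq nat :=
  [seq val a.1 | a <- L].

Lemma uniq_row_numbers N (L : seq ('I_N * 'I_N)) :
  uniq (row_numbers L) = uniq (unzip1 L).
Proof. by rewrite -(map_inj_uniq val_inj) -map_comp. Qed.

Lemma row_numbers_omit N i (L : seq ('I_N * 'I_N)) :
  row_numbers (omit i L) = omit i (row_numbers L).
Proof. by rewrite /row_numbers map_cat map_take map_drop. Qed.

Lemma placement_perm_inj N m (L L' : placement N m) :
  perm_eq (val L) (val L') -> L = L'.
Proof.
move=> LL'; apply/val_inj.
have sorted_rows (K : placement N m) : sorted (relpre (fun a => val a.1) ltn) (val K).
  by rewrite -sorted_map; have /and4P[] := placementP K.
apply: (@irr_sorted_eq _ (relpre (fun a => val a.1) ltn)) => //.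
- by move=> a b c /=; apply: ltn_trans.
- by move=> a /=; apply: ltnn.
- exact: perm_mem.
Qed.

Section Boards.
Variables p n : nat.

Lemma epi_flatten (Z : seq (seq 'I_p.+1)) :
  is_epi n Z -> perm_eq (flatten Z) (enum 'I_p.+1).
Proof. by case/and4P. Qed.

Lemma epi_uniq (Z : seq (seq 'I_p.+1)) : is_epi n Z -> uniq (flatten Z).
Proof. by move/epi_flatten/perm_uniq->; apply: enum_uniq. Qed.

Lemma epi_nonempty (Z : seq (seq 'I_p.+1)) : is_epi n Z -> [::] \notin Z.
Proof. by case/and4P=> _ _ /allP nZ _; apply/negP => /nZ. Qed.

Lemma epi_placement (Z : Epi p n) :
  exists L : placement p.+1 n, perm_eq (arcs (val Z)) (val L).
Proof.
have uZ := epi_uniq (epiP Z).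
pose le_row (a b : 'I_p.+1 * 'I_p.+1) := (a.1 <= b.1)%N.
pose L := sort le_row (arcs (val Z)).
have pL : perm_eq L (arcs (val Z)) by rewrite perm_sort.
suff PL : is_placement n L by exists (Placement PL); rewrite perm_sym.
apply/and4P; split.
- by rewrite (perm_size pL) size_arcs (tdeg_epi (epiP Z)).
- rewrite -/(row_numbers L) ltn_sorted_uniq_leq uniq_row_numbers.
  rewrite (perm_uniq (perm_map _ pL)) uniq_rows_arcs //=.
  by rewrite sorted_map; apply: sort_sorted => a b; apply: leq_total.
- by rewrite (perm_uniq (perm_map _ pL)) uniq_cols_arcs.
- by apply: cycle_free_subset (cycle_free_arcs uZ) => a; rewrite (perm_mem pL).
Qed.

Lemma placement_epi (L : placement p.+1 n) :
  exists Z : Epi p n, perm_eq (arcs (val Z)) (val L).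
Proof.
have /and4P[/eqP sL sorL uL cfL] := placementP L.
have uL1 : uniq (unzip1 L).
  by rewrite -uniq_row_numbers (sorted_uniq ltn_trans ltnn).
have [Z [nZ fZ aZ]] := tensor_of_arcs uL1 uL cfL.
suff eZ : is_epi n Z by exists (MkEpi eZ).
have sZ : (n + size Z = p.+1)%N.
  have := perm_size (perm_heads Z); rewrite (perm_size fZ) -cardE card_ord => sF.
  apply: etrans (esym sF); rewrite size_cat size_map (perm_size aZ) sL addnC; congr addn.
  rewrite size_flatten sumnE !big_map -sum1_size big_seq [RHS]big_seq.
  by apply: eq_bigr => -[|x W] WZ; [rewrite WZ in nZ | rewrite /= take0].
have Z0 : (0 < size Z)%N.
  by case: Z {nZ aZ sZ} fZ => //= /perm_size; rewrite -cardE card_ord.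
have [np sZ'] : (n <= p)%N /\ size Z = (p - n).+1 by split; lia.
apply/and4P; split; rewrite ?sZ' //.
by apply/allP => W; apply: contraTneq => ->.
Qed.

End Boards.

(** * Orientations *)

Section Orientation.
Variables (k : comPzRingType) (p : nat).
Implicit Types Z : seq (seq 'I_p.+1).

Definition orientation Z : k := (-1) ^+ inversions (row_numbers (arcs Z)).

Lemma orientationK Z : orientation Z * orientation Z = 1.
Proof. by rewrite -expr2 sqrr_sign. Qed.

Lemma orientation_swap n A W V B : is_epi n (A ++ [:: W, V & B]) ->
  orientation (A ++ [:: W, V & B]) =
  (-1) ^+ (mdeg W * mdeg V) * orientation (A ++ [:: V, W & B]).
Proof.
move=> eZ; rewrite /orientation -exprD; apply: sign_parity.
have := uniq_rows_arcs (epi_uniq eZ); rewrite -uniq_row_numbers.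
rewrite !arcs_cat !arcs_cons /row_numbers !map_cat => u.
rewrite inversions_swap ?oddD ?size_map ?size_word_arcs //.
by move: u; rewrite cat_uniq => /and3P[_ _]; rewrite catA cat_uniq => /andP[].
Qed.

Section Degree.
Variable n : nat.
Local Notation S := (Defs.span (@sym_rel k p n)).
Local Notation pi := (lquot_pi S).

(** The class of a tensor, normalised so as to depend only on its arcs. *)
Definition oriented Z : Sym_obj k p n := orientation Z *: pi (raw k n Z).

Lemma raw_not_epi Z : ~~ is_epi n Z -> raw k n Z = 0.
Proof.
move=> nZ; apply/ffunP => X; rewrite !ffunE; case: eqP => // XZ.
by rewrite -XZ epiP in nZ.
Qed.

(** The sign of the defining relation of [Sym] cancels the one in
    [orientation_swap].  When the list of words is not an element of [Epi],
    both sides are zero, so the lemma holds without a condition and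
    [perm_adjacent_eq] applies to it. *)
Lemma oriented_swap A W V B :
  oriented (A ++ [:: W, V & B]) = oriented (A ++ [:: V, W & B]).
Proof.
have piE : pi (raw k n (A ++ [:: W, V & B])) =
    (-1) ^+ (mdeg W * mdeg V) *: pi (raw k n (A ++ [:: V, W & B])).
  by rewrite -linearZ; apply/lquot_piP; apply: raw_swap.
rewrite /oriented piE.
have [eZ|nZ] := boolP (is_epi n (A ++ [:: V, W & B])); last first.
  by rewrite raw_not_epi // linear0 !scaler0.
by rewrite (orientation_swap eZ) scalerA mulnC mulrC.
Qed.

Lemma oriented_arcs Z Z' : is_epi n Z -> is_epi n Z' ->
  perm_eq (arcs Z) (arcs Z') -> oriented Z = oriented Z'.
Proof.
move=> eZ eZ' ZZ'; apply: (perm_adjacent_eq oriented_swap).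
apply: arcs_perm_inj ZZ';
  rewrite ?(epi_uniq eZ) ?(epi_nonempty eZ) ?(epi_nonempty eZ') //.
by rewrite (permPl (epi_flatten eZ)) perm_sym (epi_flatten eZ').
Qed.

(** * The isomorphism *)

Definition tensor_of (L : placement p.+1 n) : Epi p n := xchoose (placement_epi L).
Definition board_of (Z : Epi p n) : placement p.+1 n := xchoose (epi_placement Z).

Definition to_tensors : freeMod k (placement p.+1 n) -> freeMod k (Epi p n) :=
  lin_ext (fun L => orientation (val (tensor_of L)) *: gen k (tensor_of L)).
HB.instance Definition _ := GRing.Linear.on to_tensors.

Definition to_boards : freeMod k (Epi p n) -> freeMod k (placement p.+1 n) :=
  lin_ext (fun Z : Epi p n => orientation (val Z) *: gen k (board_of Z)).
HB.instance Definition _ := GRing.Linear.on to_boards.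

Definition omega : freeMod k (placement p.+1 n) -> Sym_obj k p n :=
  pi \o to_tensors.
HB.instance Definition _ := GRing.Linear.on omega.

(** The value of [omega] can be computed from any tensor with the right arcs,
    not only from the one chosen in its definition. *)
Lemma omega_gen Z (L : placement p.+1 n) : is_epi n Z -> perm_eq (arcs Z) (val L) ->
  omega (gen k L) = oriented Z.
Proof.
move=> eZ ZL; rewrite /omega /= /to_tensors lin_ext_gen linearZ /= gen_raw.
apply: oriented_arcs => //; first exact: epiP.
by rewrite (permPl (xchooseP (placement_epi L))) perm_sym.
Qed.

Lemma to_boards_gen (Z : Epi p n) (L : placement p.+1 n) :
  perm_eq (arcs (val Z)) (val L) ->
  to_boards (gen k Z) = orientation (val Z) *: gen k L.
Proof.
move=> ZL; rewrite /to_boards lin_ext_gen; congr (_ *: gen k _).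
apply: placement_perm_inj; apply: perm_trans ZL.
by rewrite perm_sym (xchooseP (epi_placement Z)).
Qed.

(** The two sides of a relation have the same placement, and their orientations
    differ by the sign of the relation. *)
Lemma to_boards_rel v : v \in S -> to_boards v = 0.
Proof.
move/asboolP; elim=> [|a _ u [A B W V Z Z' eZ eZ'] _ IH]; first exact: linear0.
rewrite linearP /= IH addr0 linearB linearZ /=.
have [L ZL] := epi_placement Z; have ZL' : perm_eq (arcs (val Z')) (val L).
  apply: perm_trans ZL; rewrite [val Z]eZ [val Z']eZ'; apply: perm_arcs.
  by rewrite perm_cat2l (perm_catCA [:: V] [:: W]).
rewrite (to_boards_gen ZL) (to_boards_gen ZL') [val Z]eZ [val Z']eZ' scalerA.
by rewrite -(@orientation_swap n) ?subrr ?scaler0 // -eZ epiP.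
Qed.

Lemma to_tensorsK : cancel to_tensors to_boards.
Proof.
move=> v; apply/eqP; rewrite -subr_eq0; apply/eqP; move: v.
apply: (@linear_gen0 _ _ _ ((to_boards \o to_tensors) \- idfun)) => L /=.
rewrite /to_tensors lin_ext_gen linearZ /=.
rewrite (to_boards_gen (xchooseP (placement_epi L))) scalerA.
by rewrite orientationK scale1r subrr.
Qed.

Lemma to_boardsK v : omega (to_boards v) = pi v.
Proof.
apply/eqP; rewrite -subr_eq0; apply/eqP; move: v.
apply: (@linear_gen0 _ _ _ ((omega \o to_boards) \- pi)) => Z /=.
have [L ZL] := epi_placement Z.
rewrite (to_boards_gen ZL) linearZ /= (omega_gen (epiP Z) ZL).
by rewrite scalerA orientationK scale1r gen_raw subrr.
Qed.

(** [to_boards] vanishes on the relations, so it does not depend on the chosen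
    representative of a class and inverts [omega]. *)
Lemma omega_bijective : bijective omega.
Proof.
exists (to_boards \o @lquot_repr _ _ _) => [v|x] /=; last first.
  by rewrite to_boardsK lquot_reprK.
have : lquot_repr (omega v) - to_tensors v \in S.
  by apply/lquot_piP; rewrite lquot_reprK.
by move/to_boards_rel; rewrite linearB => /subr0_eq->; apply: to_tensorsK.
Qed.

End Degree.

(** Both sides delete the same arc, the [j]-th rook of [L] and the [i]-th arc of
    [Z]; the two signs agree by [inversions_omit_sorted]. *)
Lemma omega_face n (L : placement p.+1 n.+1) Z Y (i j : 'I_n.+1) a0 :
  is_epi n.+1 Z -> perm_eq (arcs Z) (val L) ->
  nth a0 (val L) j = nth a0 (arcs Z) i ->
  is_epi n Y -> arcs Y = omit i (arcs Z) ->
  (-1) ^+ j *: omega (gen k (face L j)) =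
  orientation Z *: ((-1) ^+ i *: lquot_pi (Defs.span (@sym_rel k p n)) (raw k n Y)).
Proof.
move=> eZ ZL ij eY arcsY.
have /and4P[/eqP sL sorL _ _] := placementP L.
have sZ : size (arcs Z) = n.+1 by rewrite size_arcs (tdeg_epi eZ).
have uZ := uniq_rows_arcs (epi_uniq eZ).
have uL : uniq (val L) by rewrite -(perm_uniq ZL) (map_uniq uZ).
have YL : perm_eq (arcs Y) (val (face L j)).
  have omitE (s : seq ('I_p.+1 * 'I_p.+1)) l :
      uniq s -> (l < size s)%N -> omit l s = rem (nth a0 s l) s.
    by move=> us ls; rewrite remE index_uniq.
  rewrite arcsY; change (perm_eq (omit i (arcs Z)) (omit j (val L))).
  rewrite !omitE ?sZ ?sL ?ltn_ord ?(map_uniq uZ) //.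
  rewrite ij -(perm_cons (nth a0 (arcs Z) i)).
  rewrite -(permPl (perm_to_rem _)) ?mem_nth ?sZ ?ltn_ord //.
  by rewrite -(permPr (perm_to_rem _)) // -ij mem_nth // sL ltn_ord.
rewrite (omega_gen eY YL) /oriented !scalerA -!exprD.
congr (_ *: _); apply: sign_parity; rewrite arcsY row_numbers_omit.
have := @inversions_omit_sorted (row_numbers (arcs Z)) (row_numbers (val L)) i j.
rewrite uniq_row_numbers !size_map sZ sL.
move=> /(_ uZ sorL (perm_map _ ZL) (ltn_ord _) (ltn_ord _)).
rewrite !(nth_map a0) ?sZ ?sL ?ltn_ord // ij => /(_ erefl).
rewrite !oddD => <-.
by do 3 case: (odd _).
Qed.

Lemma omega_d n v :
  omega (chess_d (k := k) v) = Sym_d (@omega n.+1 v).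
Proof.
have Sym_dE u : Sym_d (lquot_pi (Defs.span (@sym_rel k p n.+1)) u) =
    lquot_pi (Defs.span (@sym_rel k p n)) (epi_d u).
  by apply: (lquot_mapE (@epi_d_rel k p n)).
apply/eqP; rewrite -subr_eq0; apply/eqP; move: v.
apply: (@linear_gen0 _ _ _
  ((@omega n \o @chess_d k p.+1 n) \- (@Sym_d k p n \o @omega n.+1))) => L /=.
apply/eqP; rewrite subr_eq0; apply/eqP.
have [Z ZL] := placement_epi L; have eZ := epiP Z.
rewrite (omega_gen eZ ZL) /oriented -gen_raw -linearZ Sym_dE !linearZ /=.
rewrite epi_d_gen /cut_sum (tdeg_epi eZ) /chess_d lin_ext_gen !linear_sum /=.
have /and4P[/eqP sL _ _ _] := placementP L.
have sZ : size (arcs (val Z)) = n.+1 by rewrite size_arcs (tdeg_epi eZ).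
have uZ : uniq (arcs (val Z)) by apply: map_uniq (uniq_rows_arcs (epi_uniq eZ)).
pose a0 : 'I_p.+1 * 'I_p.+1 := (ord0, ord0).
(* Match the two sums through the position in [L] of the [i]-th arc of [Z]. *)
have inL (i : 'I_n.+1) : nth a0 (arcs (val Z)) i \in val L.
  by rewrite -(perm_mem ZL) mem_nth ?sZ.
have pos_lt (i : 'I_n.+1) : (index (nth a0 (arcs (val Z)) i) (val L) < n.+1)%N.
  by rewrite -[X in (_ < X)%N]sL index_mem.
pose pos i := Ordinal (pos_lt i).
have nth_pos i : nth a0 (val L) (pos i) = nth a0 (arcs (val Z)) i.
  by rewrite nth_index.
have pos_inj : injective pos.
  move=> i j ij; apply/val_inj/eqP.
  rewrite -(nth_uniq a0 _ _ uZ) ?sZ; [|exact: ltn_ord..].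
  by rewrite -!nth_pos ij.
rewrite (reindex_inj pos_inj); apply: eq_bigr => i _.
have itZ : (i < tdeg (val Z))%N by rewrite (tdeg_epi eZ).
have [Y cutY arcsY] := cut_arcs itZ.
have eY : is_epi n Y by have := is_epi_cut i%:Z eZ; rewrite cutY => /andP[].
rewrite cutY big_seq1 (linearZ_LR (@omega n)).
rewrite (linearZ_LR (lquot_pi (Defs.span (@sym_rel k p n)))).
exact: omega_face ZL (nth_pos i) eY arcsY.
Qed.

End Orientation.

Theorem proposition93 (k : comPzRingType) (p : nat) :
  exists omega : chainMap (SOmega k p.+1) (Sym k p), chain_isomorphism omega.
Proof.
exists (@ChainMap k (SOmega k p.+1) (Sym k p)
  (fun n => @omega k p n : {linear _ -> _}) (@omega_d k p)).
by move=> n; apply: omega_bijective.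
Qed.
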